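(* For every integer $r\ge 2$, $$\zeta(2r+1)=\frac{2\pi^2(6^{2r-2}-3^{2r-2}-2^{2r-2}+1)}{r(2r-1)\left(3^{2r}(2^{2r}+1)+2^{2r}-1\right)}\zeta(2r-1)+\frac{2\cdot6^{2r}}{r(2r-1)\left(3^{2r}(2^{2r}+1)+2^{2r}-1\right)}\left[\sum_{k=1}^{r-1}(-1)^{k-1}\frac{(r-k)(2r+2k-1)}{(2k)!}\left(\frac{\pi}{3}\right)^{2k}\zeta(2r+1-2k)+(-1)^r\left(\frac{\pi}{3}\right)^{2r}\sum_{k=0}^\infty\frac{(2k)!\,(4r+2k-1)}{(2r+2k)!}\frac{\zeta(2k)}{6^{2k}}\right].$$
   Context: $\zeta$ is the Riemann zeta function (analytically continued), so $\zeta(0)=-1/2$. An empty sum is zero. *)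

(* Defs.v *)
From Stdlib Require Export Reals Factorial Lra Lia.
From Coquelicot Require Export Coquelicot.
Open Scope R_scope.

Definition Cexp (z : C) : C :=
  (exp (Re z) * cos (Im z), exp (Re z) * sin (Im z)).

(* [x ^ z] for real [x > 0], principal branch *)
Definition RCpower (x : R) (z : C) : C := Cexp (Cmult z (RtoC (ln x))).

(* Sum of a convergent complex series; unspecified value otherwise *)
Definition CSeries (a : nat -> C) : C :=
  (Series (fun n => Re (a n)), Series (fun n => Im (a n))).

(* sum over n >= 1 of n ^ (- s), indexed from 0 *)
Definition zeta_dirichlet (s : C) : C :=
  CSeries (fun n => RCpower (INR (S n)) (Copp s)).

(* Hasse's series, convergent to the analytic continuation of the Dirichlet
   series at every s <> 1:
     1 / (s - 1) * sum_(n >= 0) 1 / (n + 1)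
                   * sum_(0 <= k <= n) (-1)^k binom(n, k) (k + 1)^(1 - s) *)
Definition zeta_hasse (s : C) : C :=
  Cmult (Cinv (Cminus s (RtoC 1)))
    (CSeries (fun n =>
       Cmult (RtoC (/ INR (S n)))
         (sum_n (fun k => Cmult (RtoC ((-1) ^ k * Binomial.C n k))
                            (RCpower (INR (S k)) (Cminus (RtoC 1) s))) n))).

(* The Riemann zeta function on C \ {1}; the value at the pole is irrelevant *)
Definition zeta (s : C) : C :=
  if Rlt_dec 1 (Re s) then zeta_dirichlet s else zeta_hasse s.

Lemma RCpower_real (x y : R) : RCpower x (RtoC y) = RtoC (Rpower x y).
Proof.
unfold RCpower, Cexp, Rpower, RtoC, Cmult; simpl.
replace (y * 0 + 0 * ln x) with 0 by ring.
rewrite cos_0, sin_0; f_equal; [|ring].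
rewrite Rmult_1_r; f_equal; ring.
Qed.

Lemma Re_sum_n (a : nat -> C) n : Re (sum_n a n) = sum_n (fun k => Re (a k)) n.
Proof.
induction n as [|n IH].
- now rewrite !sum_O.
- rewrite !sum_Sn, <- IH; reflexivity.
Qed.

Lemma Im_sum_n (a : nat -> C) n : Im (sum_n a n) = sum_n (fun k => Im (a k)) n.
Proof.
induction n as [|n IH].
- now rewrite !sum_O.
- rewrite !sum_Sn, <- IH; reflexivity.
Qed.

Lemma sum_n_RtoC (a : nat -> R) n :
  sum_n (fun k => RtoC (a k)) n = RtoC (sum_n a n).
Proof.
apply injective_projections.
- exact (Re_sum_n (fun k => RtoC (a k)) n).
- etransitivity; [exact (Im_sum_n (fun k => RtoC (a k)) n)|].
  rewrite (sum_n_ext _ (fun _ => 0)) by reflexivity.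
  rewrite sum_n_const; apply Rmult_0_r.
Qed.

Lemma CSeries_RtoC (a : nat -> R) : CSeries (fun n => RtoC (a n)) = RtoC (Series a).
Proof.
unfold CSeries; apply injective_projections; simpl; [reflexivity|].
apply is_series_unique.
change (is_lim_seq (sum_n (fun _ => 0)) 0).
apply (is_lim_seq_ext (fun _ => 0)); [|apply is_lim_seq_const].
intros n; symmetry; etransitivity; [apply sum_n_const|ring].
Qed.

Lemma CSeries_ext (a b : nat -> C) : (forall n, a n = b n) -> CSeries a = CSeries b.
Proof.
intros H; unfold CSeries; f_equal; apply Series_ext; intros n; now rewrite H.
Qed.

Lemma zeta_real_gt1 (x : R) :
  1 < x -> zeta (RtoC x) = RtoC (Series (fun n => Rpower (INR (S n)) (- x))).
Proof.
intros Hx; unfold zeta; destruct (Rlt_dec 1 (Re (RtoC x))) as [_|H].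
2: now destruct H.
unfold zeta_dirichlet; rewrite <- CSeries_RtoC; apply CSeries_ext; intros n.
now rewrite <- RCpower_real, RtoC_opp.
Qed.

Lemma alternating_binomial_mul (n : nat) :
  sum_n (fun k => (-1) ^ k * Binomial.C n k * INR (S k)) n =
  match n with 0%nat => 1 | 1%nat => -1 | _ => 0 end.
Proof.
assert (Hz : forall m, sum_f_R0 (fun k => Binomial.C (S m) k * (-1) ^ k * 1 ^ (S m - k)) (S m) = 0).
{ intros m; rewrite <- binomial; replace (-1 + 1) with 0 by ring; apply pow_i; lia. }
destruct n as [|[|n]].
- rewrite sum_O; unfold Binomial.C; simpl; field.
- rewrite sum_Sn, sum_O; unfold plus, Binomial.C; simpl; field.
- rewrite sum_n_Reals.
  rewrite (sum_eq _ (fun k => (-1) ^ k * Binomial.C (S (S n)) k * INR k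
                     + Binomial.C (S (S n)) k * (-1) ^ k * 1 ^ (S (S n) - k))).
  2: intros k _; rewrite S_INR, pow1; ring.
  rewrite sum_plus, Hz, decomp_sum by lia.
  simpl (Init.Nat.pred _).
  rewrite (sum_eq _ (fun k => Binomial.C (S n) k * (-1) ^ k * 1 ^ (S n - k)
                              * (- INR (S (S n))))).
  + rewrite <- scal_sum, Hz; simpl; ring.
  + intros k Hk; rewrite pow1; unfold Binomial.C.
    replace (S (S n) - S k)%nat with (S n - k)%nat by lia.
    rewrite (fact_simpl k), (fact_simpl (S n)), !mult_INR.
    change ((-1) ^ S k) with (-1 * (-1) ^ k).
    field; repeat split; try apply INR_fact_neq_0; apply not_0_INR; lia.
Qed.

Lemma zeta_0 : zeta (RtoC 0) = RtoC (- / 2).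
Proof.
unfold zeta; destruct (Rlt_dec 1 (Re (RtoC 0))) as [H|_]; [simpl in H; lra|].
unfold zeta_hasse.
set (b := fun n => / INR (S n) * match n with 0%nat => 1 | 1%nat => -1 | _ => 0 end).
rewrite (CSeries_ext _ (fun n => RtoC (b n))).
- rewrite CSeries_RtoC.
  replace (Series b) with (/ 2).
  + rewrite <- RtoC_minus, <- RtoC_inv, <- RtoC_mult by lra.
    f_equal; field.
  + symmetry; apply is_series_unique.
    change (is_lim_seq (sum_n b) (/ 2)).
    apply (is_lim_seq_incr_n _ 1), (is_lim_seq_ext (fun _ => / 2)).
    2: apply is_lim_seq_const.
    intros n; rewrite Nat.add_1_r; induction n as [|n IH].
    * rewrite sum_Sn, sum_O; unfold b, plus; simpl; field.
    * rewrite sum_Sn, <- IH; unfold b, plus; simpl; ring.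
- intros n; unfold b; rewrite RtoC_mult, <- alternating_binomial_mul, <- sum_n_RtoC.
  f_equal; apply sum_n_ext; intros k.
  rewrite <- RtoC_minus, RCpower_real, <- RtoC_mult, Rminus_0_r, Rpower_1; [easy|].
  apply lt_0_INR; lia.
Qed.

(* Main.v *)
Require Import Defs.

(** Write [x = PI / 3] and [Z s] for the sum of the [1 / n^s].  For each [n], integrating by parts
    expresses the integral over [[0, x]] of [t (2x - t) (x - t)^(2r-2) sin (n t)] by
    [cos (n x) / n^(2r+1)], [cos (n x) / n^(2r-1)] and a combination of the [1 / n^(2r+1-2k)] with
    coefficients proportional to [(r - k) (2r + 2k - 1)]; summing over [n] gives the zeta values at
    odd integers in the theorem, because [cos (n PI / 3)] is a combination of the indicators of
    [2 | n], [3 | n], [6 | n].  On the other hand the sines sum to [cot (t / 2) / 2] in the sense of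
    distributions (Dirichlet kernel and Riemann-Lebesgue), and expanding
    [t cot (t / 2) / 4 = - sum zeta(2k) (t / 2 PI)^(2k)] turns the same sum into beta integrals, that
    is, into the infinite series of the theorem.  The logarithms of the individual Clausen-type
    expansions never appear, since the weight vanishes at both ends of the interval.

    The partial fraction expansion of the cotangent comes from the moments of [cos (2 a s)] and
    [s sin (2 a s)] against [cos^(2n) s] on [[0, PI / 2]]: their recurrences in [n] telescope the
    quotient of the two, which is [1 / (2 a) - (PI / 2) cot (PI a)] at [n = 0] and tends to [0]. *)

(** * Elementary facts on real series *)

Lemma continuous_derivable (f : R -> R) t : ex_derive f t -> continuous f t.
Proof. exact (ex_derive_continuous f t). Qed.

Lemma ex_RInt_derivable (f : R -> R) a b : (forall t, ex_derive f t) -> ex_RInt f a b.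
Proof.
intros H; apply (ex_RInt_continuous (V := R_CompleteNormedModule)); intros t _.
now apply continuous_derivable.
Qed.

Lemma is_series_Rext (a b : nat -> R) l :
  (forall n, a n = b n) -> is_series a l -> is_series b l.
Proof. exact (is_series_ext (V := R_NormedModule) a b l). Qed.

Lemma is_series_Rplus (a b : nat -> R) u v :
  is_series a u -> is_series b v -> is_series (fun n => a n + b n) (u + v).
Proof. exact (is_series_plus (V := R_NormedModule) a b u v). Qed.

Lemma is_series_Rminus (a b : nat -> R) u v :
  is_series a u -> is_series b v -> is_series (fun n => a n - b n) (u - v).
Proof. exact (is_series_minus (V := R_NormedModule) a b u v). Qed.

Lemma is_series_Rmult c (a : nat -> R) u :
  is_series a u -> is_series (fun n => c * a n) (c * u).
Proof. exact (is_series_scal_l (K := R_AbsRing) c a u). Qed.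

Lemma is_series_const0 : is_series (fun _ : nat => 0) 0.
Proof.
change (is_lim_seq (sum_n (fun _ => 0)) 0).
apply (is_lim_seq_ext (fun _ => 0)); [|apply is_lim_seq_const].
intros n; rewrite sum_n_const; ring.
Qed.

Lemma sum_n_RS (a : nat -> R) n : sum_n a (S n) = sum_n a n + a (S n).
Proof. exact (sum_Sn a n). Qed.

Lemma sum_n_Rext (a b : nat -> R) n :
  (forall k, (k <= n)%nat -> a k = b k) -> sum_n a n = sum_n b n.
Proof. exact (sum_n_ext_loc (G := R_AbelianMonoid) a b n). Qed.

Lemma sum_n_Rmult c (a : nat -> R) n : sum_n (fun k => c * a k) n = c * sum_n a n.
Proof. exact (sum_n_mult_l (K := R_Ring) c a n). Qed.

(** After the first term, inverse squares are dominated by the telescoping differences of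
    [/ INR (S n)]; larger exponents are dominated by the exponent [2]. *)
Lemma ex_series_inv_pow s : (2 <= s)%nat -> ex_series (fun n => / INR (S n) ^ s).
Proof.
intros Hs.
assert (H2 : ex_series (fun n => / INR (S n) ^ 2)).
{ apply ex_series_incr_1.
  apply (ex_series_le (V := R_CompleteNormedModule) _ (fun n => / INR (S n) - / INR (S (S n)))).
  - intros n; change norm with Rabs.
    pose proof (lt_0_INR (S n) ltac:(lia)) as Hn.
    rewrite (S_INR (S n)).
    rewrite Rabs_pos_eq by (apply Rlt_le, Rinv_0_lt_compat, pow_lt; lra).
    apply (Rmult_le_reg_r (INR (S n) * (INR (S n) + 1) ^ 2)); [nra|].
    field_simplify; nra.
  - exists 1; change (is_lim_seq (sum_n (fun n => / INR (S n) - / INR (S (S n)))) 1).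
    apply (is_lim_seq_ext (fun n => 1 - / INR (S (S n)))).
    + intros n; induction n as [|n IH]; [rewrite sum_O; simpl; field|].
      rewrite sum_n_RS, <- IH; simpl; ring.
    + replace (Finite 1) with (Finite (1 - 0)) by (f_equal; ring).
      apply is_lim_seq_minus'; [apply is_lim_seq_const|].
      apply (is_lim_seq_subseq (fun n => / INR n) 0 (fun n => S (S n))).
      * apply eventually_subseq; intros; lia.
      * apply (is_lim_seq_inv _ p_infty); [apply is_lim_seq_INR|easy]. }
revert H2; apply (ex_series_le (V := R_CompleteNormedModule)).
intros n; change norm with Rabs.
pose proof (lt_0_INR (S n) ltac:(lia)) as Hn.
rewrite Rabs_pos_eq by (apply Rlt_le, Rinv_0_lt_compat, pow_lt; lra).
apply Rinv_le_contravar; [now apply pow_lt|].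
apply Rle_pow; [|easy]; rewrite S_INR; pose proof (pos_INR n); lra.
Qed.

(** * Moments against powers of the cosine, and the partial fractions of the cotangent *)

Definition cos_moment (a : R) (n : nat) : R :=
  RInt (fun s => cos (2 * a * s) * cos s ^ (2 * n)) 0 (PI / 2).

(** Equals minus one half of the [a]-derivative of [cos_moment a n], so its quotient by
    [cos_moment a n] is minus half a logarithmic derivative. *)
Definition sin_moment (a : R) (n : nat) : R :=
  RInt (fun s => s * sin (2 * a * s) * cos s ^ (2 * n)) 0 (PI / 2).

Lemma is_RInt_cos_moment a n :
  is_RInt (fun s => cos (2 * a * s) * cos s ^ (2 * n)) 0 (PI / 2) (cos_moment a n).
Proof. apply (RInt_correct (V := R_CompleteNormedModule)), ex_RInt_derivable; intros; now auto_derive. Qed.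

Lemma is_RInt_sin_moment a n :
  is_RInt (fun s => s * sin (2 * a * s) * cos s ^ (2 * n)) 0 (PI / 2) (sin_moment a n).
Proof. apply (RInt_correct (V := R_CompleteNormedModule)), ex_RInt_derivable; intros; now auto_derive. Qed.

Lemma is_RInt_derive_everywhere (f df : R -> R) (a b : R) :
  (forall t, is_derive f t (df t)) -> (forall t, ex_derive df t) ->
  is_RInt df a b (f b - f a).
Proof.
intros Hf Hdf; apply (is_RInt_derive (V := R_CompleteNormedModule)).
- intros t _; apply Hf.
- intros t _; apply continuous_derivable, Hdf.
Qed.

Lemma is_RInt_eq (f : R -> R) a b u v : is_RInt f a b u -> is_RInt f a b v -> u = v.
Proof.
intros Hu Hv; rewrite <- (is_RInt_unique (V := R_CompleteNormedModule) f a b u Hu).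
now apply (is_RInt_unique (V := R_CompleteNormedModule)).
Qed.

Lemma is_RInt_Rminus (f g : R -> R) a b u v :
  is_RInt f a b u -> is_RInt g a b v -> is_RInt (fun t => f t - g t) a b (u - v).
Proof. exact (is_RInt_minus (V := R_NormedModule) f g a b u v). Qed.

Lemma is_RInt_Rmult (f : R -> R) c a b u :
  is_RInt f a b u -> is_RInt (fun t => c * f t) a b (c * u).
Proof. exact (is_RInt_scal (V := R_NormedModule) f a b c u). Qed.

Lemma is_RInt_Rext (f g : R -> R) a b l :
  (forall t, f t = g t) -> is_RInt f a b l -> is_RInt g a b l.
Proof. intros H; apply is_RInt_ext; intros t _; apply H. Qed.

Lemma is_RInt_Rplus (f g : R -> R) a b u v :
  is_RInt f a b u -> is_RInt g a b v -> is_RInt (fun t => f t + g t) a b (u + v).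
Proof. exact (is_RInt_plus (V := R_NormedModule) f g a b u v). Qed.

Lemma is_RInt_const0 a b : is_RInt (fun _ : R => 0) a b 0.
Proof.
evar_last; [exact (is_RInt_const (V := R_NormedModule) a b 0)|].
unfold scal; simpl; unfold mult; simpl; ring.
Qed.

(** Two integrations by parts packed into one antiderivative, which vanishes at [PI / 2] through
    [cos s] and at [0] through the sines. *)
Lemma cos_moment_S a k :
  (INR (S k) ^ 2 - a ^ 2) * cos_moment a (S k)
  = INR (S k) * (INR (S k) - / 2) * cos_moment a k.
Proof.
set (n := INR (S k)).
assert (H : n * (n - / 2) * cos_moment a k - (n ^ 2 - a ^ 2) * cos_moment a (S k) = 0).
{ apply (is_RInt_eq (fun s => n * (n - / 2) * (cos (2 * a * s) * cos s ^ (2 * k))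
              - (n ^ 2 - a ^ 2) * (cos (2 * a * s) * cos s ^ (2 * S k))) 0 (PI / 2)).
  - apply is_RInt_Rminus; apply is_RInt_Rmult, is_RInt_cos_moment.
  - evar_last.
    + apply (is_RInt_derive_everywhere
        (fun s => cos s ^ (S (2 * k)) * (- (n / 2) * (sin s * cos (2 * a * s))
                                       + a / 2 * (cos s * sin (2 * a * s))))).
      * intros s; auto_derive; [easy|].
        replace (2 * S k)%nat with (S (S (2 * k))) by lia.
        rewrite <- !tech_pow_Rmult.
        change (k + (k + 0))%nat with (2 * k)%nat.
        change (match (2 * k)%nat with 0%nat => 1 | S _ => INR (2 * k) + 1 end)
          with (INR (S (2 * k))).
        rewrite (S_INR (2 * k)), mult_INR; unfold n; rewrite (S_INR k); simpl (INR 2).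
        pose proof (sin2_cos2 s) as Hsc; unfold Rsqr in Hsc.
        (* The derivative and the integrand agree only modulo [sin ^ 2 + cos ^ 2 = 1], so their
           difference is exhibited as a multiple of that relation. *)
        apply Rminus_diag_uniq.
        transitivity ((sin s * sin s + cos s * cos s - 1)
          * ((2 * INR k + 1) * ((INR k + 1) / 2) * cos s ^ (2 * k) * cos (2 * a * s)));
          [field|rewrite Hsc; ring].
      * intros s; now auto_derive.
    + cbv beta; rewrite cos_PI2, sin_0, Rmult_0_r, sin_0; simpl; ring. }
lra.
Qed.

(** This is [cos_moment_S] differentiated in [a] and multiplied by [- / 2]; an explicit
    antiderivative avoids differentiating under the integral sign. *)
Lemma sin_moment_S a k :
  (INR (S k) ^ 2 - a ^ 2) * sin_moment a (S k) + a * cos_moment a (S k)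
  = INR (S k) * (INR (S k) - / 2) * sin_moment a k.
Proof.
set (n := INR (S k)).
assert (H : n * (n - / 2) * sin_moment a k - (n ^ 2 - a ^ 2) * sin_moment a (S k)
            - a * cos_moment a (S k) = 0).
{ apply (is_RInt_eq (fun s => n * (n - / 2) * (s * sin (2 * a * s) * cos s ^ (2 * k))
              - (n ^ 2 - a ^ 2) * (s * sin (2 * a * s) * cos s ^ (2 * S k))
              - a * (cos (2 * a * s) * cos s ^ (2 * S k))) 0 (PI / 2)).
  - apply is_RInt_Rminus; [apply is_RInt_Rminus|]; apply is_RInt_Rmult.
    + apply is_RInt_sin_moment.
    + apply is_RInt_sin_moment.
    + apply is_RInt_cos_moment.
  - evar_last.
    + (* minus one half of the [a]-derivative of the antiderivative in [cos_moment_S] *)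
      apply (is_RInt_derive_everywhere
        (fun s => cos s ^ (S (2 * k)) * (- (n / 2) * (s * sin s * sin (2 * a * s))
                                       - / 4 * (cos s * sin (2 * a * s))
                                       - a / 2 * (s * cos s * cos (2 * a * s))))).
      * intros s; auto_derive; [easy|].
        replace (2 * S k)%nat with (S (S (2 * k))) by lia.
        rewrite <- !tech_pow_Rmult.
        change (k + (k + 0))%nat with (2 * k)%nat.
        change (match (2 * k)%nat with 0%nat => 1 | S _ => INR (2 * k) + 1 end)
          with (INR (S (2 * k))).
        rewrite (S_INR (2 * k)), mult_INR; unfold n; rewrite (S_INR k); simpl (INR 2).
        pose proof (sin2_cos2 s) as Hsc; unfold Rsqr in Hsc.
        apply Rminus_diag_uniq.
        transitivity ((sin s * sin s + cos s * cos s - 1)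
          * ((2 * INR k + 1) * ((INR k + 1) / 2) * cos s ^ (2 * k) * (s * sin (2 * a * s))));
          [field|rewrite Hsc; ring].
      * intros s; now auto_derive.
    + cbv beta; rewrite cos_PI2, !Rmult_0_r, sin_0; simpl; ring. }
lra.
Qed.

Lemma cos_moment_0 a : 2 * a * cos_moment a 0 = sin (PI * a).
Proof.
apply (is_RInt_eq (fun s => 2 * a * (cos (2 * a * s) * cos s ^ (2 * 0))) 0 (PI / 2)).
- apply is_RInt_Rmult, is_RInt_cos_moment.
- evar_last.
  + apply (is_RInt_derive_everywhere (fun s => sin (2 * a * s))); intros s; auto_derive; trivial.
    simpl; ring.
  + cbv beta; rewrite Rmult_0_r, sin_0, Rminus_0_r; f_equal; field.
Qed.

Lemma sin_moment_0 a :
  4 * a ^ 2 * sin_moment a 0 = sin (PI * a) - PI * a * cos (PI * a).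
Proof.
apply (is_RInt_eq (fun s => 4 * a ^ 2 * (s * sin (2 * a * s) * cos s ^ (2 * 0))) 0 (PI / 2)).
- apply is_RInt_Rmult, is_RInt_sin_moment.
- evar_last.
  + apply (is_RInt_derive_everywhere
      (fun s => sin (2 * a * s) - 2 * a * s * cos (2 * a * s))); intros s; auto_derive; trivial.
    simpl; ring.
  + cbv beta; rewrite Rmult_0_r, Rmult_0_l, sin_0.
    replace (2 * a * (PI / 2)) with (PI * a) by field; ring.
Qed.

(** For [a > / 2] the integrand changes sign, so positivity is carried from [sin (PI * a)] by the
    recurrence, whose factors stay positive for [a < 1]. *)
Lemma cos_moment_pos a n : 0 <= a < 1 -> 0 < cos_moment a n.
Proof.
intros Ha; induction n as [|n IH].
- destruct (Req_dec a 0) as [->|Ha0].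
  + unfold cos_moment; rewrite (RInt_ext _ (fun _ => 1)).
    * rewrite RInt_const; unfold scal; simpl; unfold mult; simpl; pose proof PI_RGT_0; lra.
    * intros s _; rewrite Rmult_0_r, Rmult_0_l, cos_0; simpl; ring.
  + pose proof (cos_moment_0 a) as H0.
    assert (0 < sin (PI * a)) by (apply sin_gt_0; pose proof PI_RGT_0; nra).
    nra.
- pose proof (cos_moment_S a n) as H; rewrite S_INR in H; pose proof (pos_INR n).
  assert (0 < (INR n + 1) ^ 2 - a ^ 2) by nra.
  assert (0 < (INR n + 1) * (INR n + 1 - / 2) * cos_moment a n)
    by (apply Rmult_lt_0_compat; nra).
  nra.
Qed.

(** [sin t - t * cos t] vanishes at [0] and has derivative [t * sin t]. Squared, the bound replaces
    [(s * cos s) ^ 2] by [1 - cos s ^ 2] in [sin_moment_bound]. *)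
Lemma mul_cos_le_sin s : 0 <= s <= PI / 2 -> 0 <= s * cos s <= sin s.
Proof.
intros Hs; split; [apply Rmult_le_pos; [easy|apply cos_ge_0; lra]|].
assert (H : 0 <= sin s - s * cos s); [|lra].
eapply (is_RInt_le (fun _ => 0) (fun t => t * sin t) 0 s).
- lra.
- apply is_RInt_const0.
- evar_last.
  + apply (is_RInt_derive_everywhere (fun t => sin t - t * cos t)); intros t; auto_derive; trivial; ring.
  + cbv beta; rewrite sin_0; ring.
- intros t Ht; apply Rmult_le_pos; [lra|]; apply sin_ge_0; pose proof PI_RGT_0; lra.
Qed.

(** The angle [2 * a * s] stays below [PI / 3], where the cosine is at least [/ 2]. *)
Lemma cos_moment_ge a n : 0 <= a <= / 6 -> / 2 * cos_moment 0 n <= cos_moment a n.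
Proof.
intros Ha; eapply is_RInt_le;
  [|exact (is_RInt_Rmult _ (/ 2) _ _ _ (is_RInt_cos_moment 0 n))|exact (is_RInt_cos_moment a n)|].
- pose proof PI_RGT_0; lra.
- intros s Hs; rewrite Rmult_0_r, Rmult_0_l, cos_0, Rmult_1_l.
  apply Rmult_le_compat_r; [apply pow_le, cos_ge_0; lra|].
  assert (Hc : cos (PI / 3) = / 2) by (rewrite cos_PI3; field).
  rewrite <- Hc; apply cos_decr_1; pose proof PI_RGT_0; nra.
Qed.

(** For the upper bound, [sin (2 * a * s) <= 2 * a * s] and [s * cos s <= sin s] dominate the
    integrand by [2 * a] times a difference of consecutive even powers of [cos s]. The recurrence at
    [a = 0] then supplies the factor [/ INR (S n)]. *)
Lemma sin_moment_bound a n : 0 <= a <= / 6 ->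
  0 <= sin_moment a (S n) <= / INR (S n) * cos_moment a (S n).
Proof.
intros Ha; pose proof PI_RGT_0 as Hpi.
assert (Hsin : forall s, 0 < s < PI / 2 -> 0 <= sin (2 * a * s) <= 2 * a * s).
{ intros s Hs; split; [apply sin_ge_0; nra|].
  destruct (Req_dec (2 * a * s) 0) as [->|H]; [rewrite sin_0; lra|].
  apply Rlt_le, sin_lt_x; nra. }
split.
- eapply is_RInt_le; [|exact (is_RInt_const0 _ _)|exact (is_RInt_sin_moment a (S n))|].
  + lra.
  + intros s Hs; apply Rmult_le_pos; [|apply pow_le, cos_ge_0; lra].
    apply Rmult_le_pos; [lra|now apply Hsin].
- apply Rle_trans with (2 * a * (cos_moment 0 n - cos_moment 0 (S n))).
  + eapply is_RInt_le; [|exact (is_RInt_sin_moment a (S n))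
      |exact (is_RInt_Rmult _ (2 * a) _ _ _
         (is_RInt_Rminus _ _ _ _ _ _ (is_RInt_cos_moment 0 n) (is_RInt_cos_moment 0 (S n))))|]; [lra|].
    intros s Hs; rewrite Rmult_0_r, Rmult_0_l, cos_0.
    replace (2 * S n)%nat with (S (S (2 * n))) by lia; rewrite <- !tech_pow_Rmult.
    assert (Hc : 0 <= cos s ^ (2 * n)) by (apply pow_le, cos_ge_0; lra).
    pose proof (mul_cos_le_sin s ltac:(lra)) as Hsc.
    pose proof (sin2_cos2 s) as H2; unfold Rsqr in H2.
    specialize (Hsin s Hs).
    apply Rle_trans with (s * (2 * a * s) * (cos s * (cos s * cos s ^ (2 * n)))).
    * assert (0 <= cos s) by (apply cos_ge_0; lra).
      apply Rmult_le_compat_r; [|apply Rmult_le_compat_l; [lra|easy]].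
      apply Rmult_le_pos; [easy|now apply Rmult_le_pos].
    * replace (s * (2 * a * s) * (cos s * (cos s * cos s ^ (2 * n))))
        with (2 * a * cos s ^ (2 * n) * (s * cos s * (s * cos s))) by ring.
      apply Rle_trans with (2 * a * cos s ^ (2 * n) * (sin s * sin s)).
      -- apply Rmult_le_compat_l; [nra|]; apply Rmult_le_compat; easy.
      -- apply Req_le; replace (sin s * sin s) with (1 - cos s * cos s) by lra; ring.
  + pose proof (cos_moment_S 0 n) as H.
    pose proof (cos_moment_ge a (S n) Ha) as Hge.
    pose proof (cos_moment_pos 0 (S n) ltac:(lra)) as Hp.
    set (W := cos_moment 0 (S n)) in *; set (V := cos_moment 0 n) in *.
    pose proof (pos_INR n). rewrite S_INR in *; set (u := INR n) in *.
    (* The Wallis recurrence: [cos_moment_S] at [a = 0], divided by [u + 1]. *)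
    assert (HV : (u + / 2) * (V - W) = W * / 2) by nra.
    assert (HVW : 0 <= V - W) by nra.
    apply (Rmult_le_reg_l (u + 1)); [lra|].
    replace ((u + 1) * (/ (u + 1) * cos_moment a (S n))) with (cos_moment a (S n)) by (field; lra).
    apply Rle_trans with (2 * / 6 * ((u + 1) * (V - W))); nra.
Qed.

(** Dividing [sin_moment_S] by [cos_moment_S] makes each term a difference of consecutive quotients;
    the last quotient is at most [/ INR (S n)]. *)
Lemma is_series_cot_partial_fractions a : 0 <= a <= / 6 ->
  is_series (fun n => a / (INR (S n) ^ 2 - a ^ 2)) (sin_moment a 0 / cos_moment a 0).
Proof.
intros Ha.
assert (Hp : forall n, 0 < cos_moment a n) by (intros n; apply cos_moment_pos; lra).
assert (Hsum : forall n, sum_n (fun n => a / (INR (S n) ^ 2 - a ^ 2)) n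
   = sin_moment a 0 / cos_moment a 0 - sin_moment a (S n) / cos_moment a (S n)).
{ assert (Hstep : forall n, a / (INR (S n) ^ 2 - a ^ 2)
     = sin_moment a n / cos_moment a n - sin_moment a (S n) / cos_moment a (S n)).
  { intros n; pose proof (cos_moment_S a n) as Hc; pose proof (sin_moment_S a n) as Hs.
    pose proof (Hp n); pose proof (Hp (S n)).
    assert (H1 : 1 <= INR (S n)) by (rewrite S_INR; pose proof (pos_INR n); lra).
    assert (Hd : 0 < INR (S n) ^ 2 - a ^ 2) by nra.
    assert (He : INR (S n) * (INR (S n) - / 2) <> 0) by nra.
    set (e := INR (S n) * (INR (S n) - / 2)) in *; set (d := INR (S n) ^ 2 - a ^ 2) in *.
    apply (Rmult_eq_reg_l e); [|easy].
    rewrite Rmult_minus_distr_l.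
    (* The extra factor [e] above and below exhibits the right-hand sides of both recurrences. *)
    replace (e * (sin_moment a n / cos_moment a n))
      with (e * sin_moment a n * e / (e * cos_moment a n)) by (field; split; lra).
    rewrite <- Hs, <- Hc; field; split; lra. }
  induction n as [|n IH]; [now rewrite sum_O, Hstep|].
  rewrite sum_n_RS, IH, Hstep; simpl; ring. }
change (is_lim_seq (sum_n (fun n => a / (INR (S n) ^ 2 - a ^ 2))) (sin_moment a 0 / cos_moment a 0)).
apply (is_lim_seq_ext _ _ _ (fun n => eq_sym (Hsum n))).
evar_last.
- apply is_lim_seq_minus'; [apply is_lim_seq_const|].
  apply (is_lim_seq_le_le (fun _ => 0) _ (fun n => / INR (S n))).
  + intros n; pose proof (sin_moment_bound a n Ha); specialize (Hp (S n)).
    split; [apply Rdiv_le_0_compat; easy|apply Rle_div_l; easy].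
  + apply is_lim_seq_const.
  + apply (is_lim_seq_incr_1 (fun n => / INR n)), (is_lim_seq_inv _ p_infty); [apply is_lim_seq_INR|easy].
- now rewrite Rminus_0_r.
Qed.

(** * Truncated generating function of the even zeta values *)

Definition zeta_nat (s : nat) : R := Series (fun n => / INR (S n) ^ s).

(** With zeta(0) = -1/2 as first value, the generating function is exactly
    [- (PI * a / 2) * cot (PI * a)], without a separate constant. *)
Definition zeta_even (k : nat) : R := match k with O => - / 2 | _ => zeta_nat (2 * k) end.

Definition zeta_even_sum (a : R) (M : nat) : R :=
  sum_n (fun m => zeta_even m * a ^ (2 * m)) M.

(** Each term is the finite geometric sum of [(a / INR (S n)) ^ (2 * m)] over [1 <= m <= M], so only
    a finite sum is exchanged with the series. The [/ 2] cancels the index [m = 0]. *)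
Lemma zeta_even_sum_series a M : 0 <= a <= / 6 ->
  is_series (fun n => a * (a / (INR (S n) ^ 2 - a ^ 2)) * (1 - (a / INR (S n)) ^ (2 * M)))
    (zeta_even_sum a M + / 2).
Proof.
intros Ha; induction M as [|M IH].
- unfold zeta_even_sum, zeta_even; rewrite sum_O; simpl.
  replace (_ * 1 + _) with 0 by lra.
  apply (is_series_Rext (fun _ => 0)); [|exact is_series_const0].
  intros n; change (0 = a * (a / (INR (S n) ^ 2 - a ^ 2)) * (1 - 1)); ring.
- unfold zeta_even_sum in *; rewrite sum_n_RS.
  set (s := sum_n _ M) in *.
  pose proof (is_series_Rplus _ _ _ _ IH (is_series_Rmult (a ^ (2 * S M)) _ _
    (Series_correct _ (ex_series_inv_pow (2 * S M) ltac:(lia))))) as H.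
  replace (s + _ + / 2) with
    (s + / 2 + a ^ (2 * S M) * Series (fun n => / INR (S n) ^ (2 * S M)))
    by (unfold zeta_even, zeta_nat; ring).
  revert H; apply is_series_Rext; intros n.
  assert (H1 : 1 <= INR (S n)) by (rewrite S_INR; pose proof (pos_INR n); lra).
  replace (2 * S M)%nat with (2 + 2 * M)%nat by lia; unfold Rdiv; rewrite !Rpow_mult_distr, !pow_add.
  rewrite !pow_inv.
  field; repeat split; try apply pow_nonzero; nra.
Qed.

(** Since [a <= / 6], each omitted geometric tail carries a factor at most [(/ 36) ^ M], uniformly
    in [a]. The factor [sin (PI * a)] clears the denominator of the cotangent. *)
Lemma zeta_even_sum_cot a M : 0 < a <= / 6 ->
  Rabs (2 * sin (PI * a) * zeta_even_sum a M + PI * a * cos (PI * a))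
  <= 2 * (/ 36) ^ M * sin (PI * a).
Proof.
intros Ha.
pose proof (is_series_cot_partial_fractions a ltac:(lra)) as HS.
pose proof (zeta_even_sum_series a M ltac:(lra)) as HM.
pose proof (cos_moment_0 a) as Hc; pose proof (sin_moment_0 a) as Hs.
set (q := sin_moment a 0 / cos_moment a 0) in *.
assert (HC : 0 < cos_moment a 0) by (apply cos_moment_pos; lra).
assert (Hsin : 0 < sin (PI * a)) by (apply sin_gt_0; pose proof PI_RGT_0; nra).
assert (Hq : 2 * sin (PI * a) * (a * q) = sin (PI * a) - PI * a * cos (PI * a))
  by (rewrite <- Hs, <- Hc; unfold q; field; lra).
assert (Hcos : 0 <= PI * a * cos (PI * a)).
{ pose proof PI_RGT_0; apply Rmult_le_pos; [nra|apply cos_ge_0; nra]. }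
assert (Hq1 : 0 <= a * q <= / 2).
{ split; [|nra].
  unfold q; apply Rmult_le_pos; [lra|]; apply Rdiv_le_0_compat; [|easy].
  (* [sin_moment_bound] starts at index [1]; the sign at index [0] is read off the recurrence. *)
  pose proof (sin_moment_S a 0) as HS0.
  pose proof (sin_moment_bound a 0 ltac:(lra)); pose proof (cos_moment_pos a 1 ltac:(lra)).
  assert (0 <= (1 - a * a) * sin_moment a 1) by (apply Rmult_le_pos; nra).
  assert (0 <= a * cos_moment a 1) by (apply Rmult_le_pos; lra).
  simpl in HS0; lra. }
assert (Hdiff : 0 <= a * q - (zeta_even_sum a M + / 2) <= (/ 36) ^ M * (a * q)).
{ pose proof (is_series_Rmult a _ _ HS) as HaS.
  pose proof (is_series_Rminus _ _ _ _ HaS HM) as HD.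
  assert (Hn : forall n, 0 <= (a / INR (S n)) ^ (2 * M) <= (/ 36) ^ M
            /\ 0 <= a * (a / (INR (S n) ^ 2 - a ^ 2))).
  { intros n.
    assert (H1 : 1 <= INR (S n)) by (rewrite S_INR; pose proof (pos_INR n); lra).
    split; [|apply Rmult_le_pos; [lra|apply Rdiv_le_0_compat; nra]].
    rewrite pow_mult.
    assert (Hi : 0 <= a / INR (S n) <= / 6).
    { split; [apply Rdiv_le_0_compat; lra|apply Rle_div_l; nra]. }
    split; [apply pow_le, pow_le; lra|]; apply pow_incr; nra. }
  assert (Hle : forall n, 0 <= a * (a / (INR (S n) ^ 2 - a ^ 2)) -
      a * (a / (INR (S n) ^ 2 - a ^ 2)) * (1 - (a / INR (S n)) ^ (2 * M))
      <= (/ 36) ^ M * (a * (a / (INR (S n) ^ 2 - a ^ 2)))).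
  { intros n; destruct (Hn n) as [H1 H2]; split; nra. }
  split.
  - rewrite <- (is_series_unique _ _ HD); apply Rle_trans with (Series (fun _ => 0)).
    + rewrite (is_series_unique _ _ is_series_const0); lra.
    + apply Series_le; [intros n; split; [lra|apply Hle]|exact (ex_intro _ _ HD)].
  - rewrite <- (is_series_unique _ _ HD), <- (is_series_unique _ _ (is_series_Rmult ((/ 36) ^ M) _ _ HaS)).
    apply Series_le; [exact Hle|].
    eexists; apply (is_series_Rmult ((/ 36) ^ M) _ _ HaS). }
replace (2 * sin (PI * a) * zeta_even_sum a M + PI * a * cos (PI * a))
  with (- (2 * sin (PI * a) * (a * q - (zeta_even_sum a M + / 2)))) by lra.
rewrite Rabs_Ropp, Rabs_pos_eq by (apply Rmult_le_pos; lra).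
assert (0 < (/ 36) ^ M) by (apply pow_lt; lra).
apply Rle_trans with (2 * sin (PI * a) * ((/ 36) ^ M * 1)); [|lra].
apply Rmult_le_compat_l; nra.
Qed.

(** * Summing the sine integrals *)

(** Differentiability of [df] makes it continuous, which is what the integration by parts in
    [riemann_lebesgue] calls for. *)
Definition C2 (f : R -> R) : Prop :=
  exists df : R -> R, (forall t, is_derive f t (df t)) /\ (forall t, ex_derive df t).

Lemma C2_derivable f t : C2 f -> ex_derive f t.
Proof. intros (df & H & _); exists (df t); apply H. Qed.

Lemma C2_ext f g : (forall t, f t = g t) -> C2 f -> C2 g.
Proof.
intros He (df & H & H'); exists df; split; [|easy].
intros t; apply (is_derive_ext f g); auto.
Qed.

Lemma C2_affine a b : C2 (fun t => a * t + b).
Proof. exists (fun _ => a); split; intros t; auto_derive; trivial; ring. Qed.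

Lemma C2_plus f g : C2 f -> C2 g -> C2 (fun t => f t + g t).
Proof.
intros (df & Hf & Hf') (dg & Hg & Hg'); exists (fun t => df t + dg t); split; intros t.
- exact (is_derive_plus f g t _ _ (Hf t) (Hg t)).
- exact (ex_derive_plus df dg t (Hf' t) (Hg' t)).
Qed.

Lemma C2_mult f g : C2 f -> C2 g -> C2 (fun t => f t * g t).
Proof.
intros Hf2 Hg2; generalize Hf2 Hg2.
intros (df & Hf & Hf') (dg & Hg & Hg'); exists (fun t => df t * g t + f t * dg t); split; intros t.
- apply (is_derive_mult f g t); trivial; intros n m; apply Rmult_comm.
- apply (ex_derive_plus (fun t => df t * g t) (fun t => f t * dg t));
    apply ex_derive_mult; trivial; now apply C2_derivable.
Qed.

Lemma C2_const c : C2 (fun _ => c).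
Proof. apply (C2_ext (fun t => 0 * t + c)); [intros; ring|apply C2_affine]. Qed.

Lemma C2_pow f n : C2 f -> C2 (fun t => f t ^ n).
Proof. intros Hf; induction n as [|n IH]; [exact (C2_const 1)|exact (C2_mult f (fun t => f t ^ n) Hf IH)]. Qed.

Lemma C2_sum_n (f : nat -> R -> R) n : (forall k, C2 (f k)) -> C2 (fun t => sum_n (fun k => f k t) n).
Proof.
intros Hf; induction n as [|n IH].
- apply (C2_ext (f 0%nat)); [intros; now rewrite sum_O|easy].
- apply (C2_ext (fun t => sum_n (fun k => f k t) n + f (S n) t)); [intros; now rewrite sum_n_RS|].
  now apply C2_plus.
Qed.

(** One integration by parts gives the rate [B / INR (S N)]. The phase lets one statement serve
    cosines ([phi = 0]) and sines ([phi = - (PI / 2)]). *)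
Lemma riemann_lebesgue f x phi : 0 <= x -> C2 f ->
  is_lim_seq (fun N => RInt (fun t => f t * cos (INR (S N) * t + phi)) 0 x) 0.
Proof.
intros Hx (df & Hf & Hdf).
assert (Hfd : forall t, ex_derive f t) by (intros t; exists (df t); apply Hf).
set (B := Rabs (f x) + Rabs (f 0) + RInt (fun t => Rabs (df t)) 0 x).
assert (Hcont : forall g : R -> R, (forall t, ex_derive g t) -> ex_RInt (fun t => Rabs (g t)) 0 x).
{ intros g Hg; apply (ex_RInt_continuous (V := R_CompleteNormedModule)); intros t _.
  apply (continuous_comp g Rabs); [apply continuous_derivable, Hg|apply continuous_Rabs]. }
assert (Hb : forall N, Rabs (RInt (fun t => f t * cos (INR (S N) * t + phi)) 0 x) <= B * / INR (S N)).
{ intros N; set (n := INR (S N)).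
  assert (Hn : 0 < n) by (apply lt_0_INR; lia).
  assert (Hs : forall t, ex_derive (fun t => df t * sin (n * t + phi)) t).
  { intros t; apply ex_derive_mult; [apply Hdf|now auto_derive]. }
  assert (Heq : RInt (fun t => f t * cos (n * t + phi)) 0 x
    = / n * (f x * sin (n * x + phi) - f 0 * sin (n * 0 + phi))
      - / n * RInt (fun t => df t * sin (n * t + phi)) 0 x).
  { apply (is_RInt_unique (V := R_CompleteNormedModule)).
    (* The first bracket is the derivative of [f t * sin (n * t + phi)]. *)
    apply (is_RInt_Rext (fun t => / n * (df t * sin (n * t + phi) + n * (f t * cos (n * t + phi)))
              - / n * (df t * sin (n * t + phi)))); [intros t; field; lra|].
    apply is_RInt_Rminus; apply is_RInt_Rmult.
    - apply (is_RInt_derive_everywhere (fun t => f t * sin (n * t + phi))); intros t.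
      + evar_last; [apply (is_derive_mult f (fun t => sin (n * t + phi)));
          [apply Hf|auto_derive; trivial|intros; apply Rmult_comm]|].
        unfold plus, mult; simpl; ring.
      + apply (ex_derive_plus (fun t => df t * sin (n * t + phi)) (fun t => n * (f t * cos (n * t + phi)))).
        * apply Hs.
        * apply ex_derive_scal, ex_derive_mult; [apply Hfd|now auto_derive].
    - now apply (RInt_correct (V := R_CompleteNormedModule)), ex_RInt_derivable. }
  rewrite Heq, <- Rmult_minus_distr_l, Rabs_mult, Rmult_comm.
  rewrite (Rabs_pos_eq (/ n)) by (apply Rlt_le, Rinv_0_lt_compat, Hn).
  apply Rmult_le_compat_r; [apply Rlt_le, Rinv_0_lt_compat, Hn|].
  assert (Hsin : forall u v, Rabs (u * sin v) <= Rabs u).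
  { intros u v; rewrite Rabs_mult; rewrite <- (Rmult_1_r (Rabs u)) at 2.
    apply Rmult_le_compat_l; [apply Rabs_pos|]; apply Rabs_le, SIN_bound. }
  assert (HI : Rabs (RInt (fun t => df t * sin (n * t + phi)) 0 x)
               <= RInt (fun t => Rabs (df t)) 0 x).
  { eapply Rle_trans; [apply abs_RInt_le; [easy|now apply ex_RInt_derivable]|].
    apply RInt_le; [easy|now apply Hcont|now apply Hcont|intros; apply Hsin]. }
  pose proof (Hsin (f x) (n * x + phi)); pose proof (Hsin (f 0) (n * 0 + phi)).
  unfold B; revert HI; split_Rabs; lra. }
assert (H0 : forall c, is_lim_seq (fun N => c * / INR (S N)) 0).
{ intros c; replace (Finite 0) with (Rbar_mult c 0) by (simpl; f_equal; ring).
  apply is_lim_seq_scal_l, (is_lim_seq_incr_1 (fun n => / INR n)), (is_lim_seq_inv _ p_infty);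
    [apply is_lim_seq_INR|easy]. }
apply (is_lim_seq_le_le (fun N => - B * / INR (S N)) _ (fun N => B * / INR (S N))); [|apply H0|apply H0].
intros N; specialize (Hb N); apply Rabs_le_between in Hb; lra.
Qed.

(** The product telescopes to [cos (t / 2) - cos ((N + 3 / 2) t)], written here with the last cosine
    expanded so that only the frequency [INR (S N)] oscillates. *)
Lemma sin_sum (t : R) N :
  2 * sin (t / 2) * sum_n (fun n => sin (INR (S n) * t)) N
  = cos (t / 2) * (1 - cos (INR (S N) * t)) + sin (INR (S N) * t) * sin (t / 2).
Proof.
assert (Hs : forall u, sin (u + t) = sin u * cos t + cos u * sin t) by (intros; apply sin_plus).
assert (Hc : forall u, cos (u + t) = cos u * cos t - sin u * sin t) by (intros; apply cos_plus).
assert (Ht : sin t = 2 * sin (t / 2) * cos (t / 2)).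
{ rewrite <- sin_2a; f_equal; field. }
assert (Htc : cos t = 1 - 2 * sin (t / 2) * sin (t / 2)).
{ rewrite <- cos_2a_sin; f_equal; field. }
pose proof (sin2_cos2 (t / 2)) as H2; unfold Rsqr in H2.
set (s := sin (t / 2)) in *; set (c := cos (t / 2)) in *.
induction N as [|N IH].
- rewrite sum_O; simpl (INR 1); rewrite !Rmult_1_l, Htc, Ht.
  replace (1 - (1 - 2 * s * s)) with (2 * s * s) by ring.
  ring.
- rewrite sum_n_RS, Rmult_plus_distr_l, IH.
  rewrite (S_INR (S N)), Rmult_plus_distr_r, Rmult_1_l, Hs, Hc, Ht, Htc.
  set (u := sin (INR (S N) * t)); set (v := cos (INR (S N) * t)).
  apply Rminus_diag_uniq.
  transitivity (2 * s * u * (1 - (s * s + c * c)) ); [ring|rewrite H2; ring].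
Qed.

Lemma is_RInt_sum_n (f : nat -> R -> R) a b n :
  (forall k t, ex_derive (f k) t) ->
  is_RInt (fun t => sum_n (fun k => f k t) n) a b (sum_n (fun k => RInt (f k) a b) n).
Proof.
intros Hf.
assert (Hk : forall k, is_RInt (f k) a b (RInt (f k) a b)).
{ intros k; now apply (RInt_correct (V := R_CompleteNormedModule)), ex_RInt_derivable. }
induction n as [|n IH].
- rewrite sum_O; apply (is_RInt_Rext (f 0%nat)); [intros; now rewrite sum_O|apply Hk].
- rewrite sum_n_RS; apply (is_RInt_Rext (fun t => sum_n (fun k => f k t) n + f (S n) t));
    [intros; now rewrite sum_n_RS|].
  exact (is_RInt_Rplus _ _ a b _ _ IH (Hk (S n))).
Qed.

Lemma C2_zeta_even_sum M : C2 (fun t => zeta_even_sum (t / (2 * PI)) M).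
Proof.
unfold zeta_even_sum.
apply (C2_sum_n (fun m t => zeta_even m * (t / (2 * PI)) ^ (2 * m))).
intros m; apply C2_mult; [apply C2_const|apply C2_pow].
apply (C2_ext (fun t => / (2 * PI) * t + 0)); [intros; unfold Rdiv; ring|apply C2_affine].
Qed.

(* Both sides of the bound are compared after multiplication by [2 sin (t / 2)],
   which turns the sine sum into the Dirichlet form of [sin_sum] and lets
   [zeta_even_sum_cot] at [a = t / (2 PI)] absorb the cotangent. *)
Lemma sine_kernel_approx (q Q t : R) M N : 0 <= t <= PI / 3 -> Rabs q <= Q ->
  let P := zeta_even_sum (t / (2 * PI)) M in
  Rabs (t * q * sum_n (fun n => sin (INR (S n) * t)) N + 2 * (q * P)
        - 2 * (q * P * cos (INR (S N) * t)) - / 2 * (t * q * sin (INR (S N) * t)))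
  <= 4 * Q * (/ 36) ^ M.
Proof.
intros Ht HQ P; pose proof PI_RGT_0 as Hpi.
assert (H36 : 0 < (/ 36) ^ M) by (apply pow_lt; lra).
pose proof (Rabs_pos q).
(* At [t = 0] the multiplier [2 * sin (t / 2)] vanishes, but so does the expression to be
   bounded. *)
destruct (Req_dec t 0) as [->|Ht0].
{ rewrite Rmult_0_r, cos_0.
  match goal with |- Rabs ?e <= _ => replace e with 0 by ring end.
  rewrite Rabs_R0; apply Rmult_le_pos; lra. }
pose proof (sin_sum t N) as HD.
assert (Ha : 0 < t / (2 * PI) <= / 6).
{ split; [apply Rdiv_lt_0_compat; lra|apply Rle_div_l; lra]. }
pose proof (zeta_even_sum_cot _ M Ha) as HP; fold P in HP.
replace (PI * (t / (2 * PI))) with (t / 2) in HP by (field; lra).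
assert (Hs : 0 < sin (t / 2)) by (apply sin_gt_0; lra).
set (D := sum_n _ N) in *; set (co := cos (INR (S N) * t)) in *; set (si := sin (INR (S N) * t)) in *.
apply (Rmult_le_reg_l (2 * sin (t / 2))); [lra|].
rewrite <- (Rabs_pos_eq (2 * sin (t / 2))) at 1 by lra.
rewrite <- Rabs_mult.
(* By [sin_sum] the terms in [si] cancel, leaving [2 * q * (1 - co)] times the quantity bounded by
   [zeta_even_sum_cot]. *)
match goal with |- Rabs ?e <= _ => replace e with
  (q * (1 - co) * (2 * (2 * sin (t / 2) * P + t / 2 * cos (t / 2)))) end.
2: { transitivity (t * q * (2 * sin (t / 2) * D) + 4 * sin (t / 2) * q * P * (1 - co) - sin (t / 2) * t * q * si);
  [rewrite HD; field|field]. }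
rewrite !Rabs_mult, (Rabs_pos_eq 2) by lra.
assert (Hco : Rabs (1 - co) <= 2).
{ pose proof (COS_bound (INR (S N) * t)); unfold co; apply Rabs_le; lra. }
apply Rle_trans with (Q * 2 * (2 * (2 * (/ 36) ^ M * sin (t / 2)))); [|lra].
apply Rmult_le_compat; [apply Rmult_le_pos; apply Rabs_pos| | |lra].
- apply Rmult_le_pos; [lra|apply Rabs_pos].
- apply Rmult_le_compat; trivial; apply Rabs_pos.
Qed.

(** The factor [t] cancels the pole of [cot (t / 2)]. For fixed [M], adding more and more sines
    kills the oscillating terms by [riemann_lebesgue] and leaves an error of order [(/ 36) ^ M];
    only then does [M] grow. *)
Lemma series_sine_integrals q x Q L : 0 < x <= PI / 3 -> C2 q ->
  (forall t, 0 <= t <= x -> Rabs (q t) <= Q) ->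
  is_series (fun n => RInt (fun t => t * q t * sin (INR (S n) * t)) 0 x) L ->
  is_lim_seq (fun M => -2 * RInt (fun t => q t * zeta_even_sum (t / (2 * PI)) M) 0 x) L.
Proof.
intros Hx Hq HQ HL.
assert (Htq : C2 (fun t => t * q t)).
{ apply C2_mult; [|easy]; apply (C2_ext (fun t => 1 * t + 0)); [intros; ring|apply C2_affine]. }
assert (Hqd := fun t => C2_derivable _ t Hq).
assert (Htqd := fun t => C2_derivable _ t Htq).
set (V := fun M => RInt (fun t => q t * zeta_even_sum (t / (2 * PI)) M) 0 x).
assert (Hbound : forall M, Rabs (L + 2 * V M) <= 4 * Q * x * (/ 36) ^ M).
{ intros M.
  assert (HqP : C2 (fun t => q t * zeta_even_sum (t / (2 * PI)) M))
    by (apply C2_mult; [easy|apply C2_zeta_even_sum]).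
  assert (HqPd := fun t => C2_derivable _ t HqP).
  set (c := fun N => RInt (fun t => q t * zeta_even_sum (t / (2 * PI)) M * cos (INR (S N) * t)) 0 x).
  set (s := fun N => RInt (fun t => t * q t * sin (INR (S N) * t)) 0 x).
  assert (Hc : is_lim_seq c 0).
  { eapply is_lim_seq_ext; [|apply (riemann_lebesgue _ x 0 ltac:(lra) HqP)].
    intros N; apply RInt_ext; intros t _; cbv beta; now rewrite Rplus_0_r. }
  assert (Hs : is_lim_seq s 0).
  { eapply is_lim_seq_ext; [|apply (riemann_lebesgue _ x (- (PI / 2)) ltac:(lra) Htq)].
    intros N; apply RInt_ext; intros t _; cbv beta.
    change (INR (S N) * t + - (PI / 2)) with (INR (S N) * t - PI / 2).
    now rewrite <- cos_neg, Ropp_minus_distr, cos_shift. }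
  assert (HsI : forall N, is_RInt (fun t => t * q t * sin (INR (S N) * t)) 0 x (s N)).
  { intros N; apply (RInt_correct (V := R_CompleteNormedModule)), ex_RInt_derivable.
    intros t; apply ex_derive_mult; [apply Htqd|now auto_derive]. }
  assert (HcI : forall N, is_RInt (fun t => q t * zeta_even_sum (t / (2 * PI)) M * cos (INR (S N) * t)) 0 x (c N)).
  { intros N; apply (RInt_correct (V := R_CompleteNormedModule)), ex_RInt_derivable.
    intros t; apply ex_derive_mult; [apply HqPd|now auto_derive]. }
  assert (HVI : is_RInt (fun t => q t * zeta_even_sum (t / (2 * PI)) M) 0 x (V M)).
  { now apply (RInt_correct (V := R_CompleteNormedModule)), ex_RInt_derivable. }
  assert (HuI : forall N, is_RInt (fun t => t * q t * sum_n (fun n => sin (INR (S n) * t)) N) 0 x (sum_n s N)).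
  { intros N; eapply is_RInt_Rext; [|apply is_RInt_sum_n].
    - intros t; cbv beta.
      exact (sum_n_mult_l (K := R_Ring) (t * q t) (fun n => sin (INR (S n) * t)) N).
    - intros k t; apply ex_derive_mult; [apply Htqd|now auto_derive]. }
  assert (HN : forall N, Rabs (sum_n s N + 2 * V M - 2 * c N - / 2 * s N) <= 4 * Q * x * (/ 36) ^ M).
  { intros N.
    replace (4 * Q * x * (/ 36) ^ M) with ((x - 0) * (4 * Q * (/ 36) ^ M)) by ring.
    apply (norm_RInt_le_const (V := R_NormedModule) (fun t =>
       t * q t * sum_n (fun n => sin (INR (S n) * t)) N
       + 2 * (q t * zeta_even_sum (t / (2 * PI)) M)
       - 2 * (q t * zeta_even_sum (t / (2 * PI)) M * cos (INR (S N) * t))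
       - / 2 * (t * q t * sin (INR (S N) * t)))); [lra| |].
    - intros t Ht; apply (sine_kernel_approx (q t) Q t M N); [simpl in Ht; lra|now apply HQ].
    - apply is_RInt_Rminus; [apply is_RInt_Rminus|apply is_RInt_Rmult, HsI].
      + apply is_RInt_Rplus; [apply HuI|now apply is_RInt_Rmult].
      + apply is_RInt_Rmult, HcI. }
  apply (is_lim_seq_le (fun N => Rabs (sum_n s N + 2 * V M - 2 * c N - / 2 * s N))
    (fun _ => 4 * Q * x * (/ 36) ^ M) (Rabs (L + 2 * V M)) (4 * Q * x * (/ 36) ^ M)); [exact HN| |apply is_lim_seq_const].
  apply (is_lim_seq_abs _ (L + 2 * V M)).
  replace (L + 2 * V M) with (L + 2 * V M - 2 * 0 - / 2 * 0) by ring.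
  apply is_lim_seq_minus'; [apply is_lim_seq_minus'; [apply is_lim_seq_plus'; [exact HL|apply is_lim_seq_const]|]|].
  - exact (is_lim_seq_scal_l _ 2 _ Hc).
  - exact (is_lim_seq_scal_l _ (/ 2) _ Hs). }
assert (H0 : is_lim_seq (fun M => 4 * Q * x * (/ 36) ^ M) 0).
{ replace (Finite 0) with (Rbar_mult (4 * Q * x) 0) by (simpl; f_equal; ring).
  apply is_lim_seq_scal_l, is_lim_seq_geom; rewrite Rabs_pos_eq; lra. }
apply (is_lim_seq_le_le (fun M => L - 4 * Q * x * (/ 36) ^ M) _ (fun M => L + 4 * Q * x * (/ 36) ^ M)).
- intros M; specialize (Hbound M); apply Rabs_le_between in Hbound; unfold V in Hbound; lra.
- replace L with (L - 0) at 1 by ring; apply is_lim_seq_minus'; [apply is_lim_seq_const|easy].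
- replace L with (L + 0) at 1 by ring; apply is_lim_seq_plus'; [apply is_lim_seq_const|easy].
Qed.

(** * Evaluation of the two sides *)

(** Induction on [j] for all [i]: an integration by parts trades a factor [x - t] for a factor
    [t]. *)
Lemma beta_integral x i j :
  is_RInt (fun t => (x - t) ^ j * t ^ i) 0 x
    (INR (fact i) * INR (fact j) / INR (fact (S (i + j))) * x ^ S (i + j)).
Proof.
revert i; induction j as [|j IH]; intros i.
- assert (Hi : INR (S i) <> 0) by (apply not_0_INR; lia).
  replace (INR (fact i) * INR (fact 0) / INR (fact (S (i + 0))) * x ^ S (i + 0))
    with (/ INR (S i) * x ^ S i - / INR (S i) * 0 ^ S i).
  2: { rewrite Nat.add_0_r, fact_simpl, mult_INR, pow_i by lia; simpl (fact 0); simpl (INR 1).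
       field; repeat split; apply INR_fact_neq_0 || apply Hi. }
  apply (is_RInt_derive_everywhere (fun t => / INR (S i) * t ^ S i)); intros t; auto_derive; trivial.
  change (match i with 0%nat => 1 | S _ => INR i + 1 end) with (INR (S i)); simpl; field; easy.
- assert (Hi : INR (S i) <> 0) by (apply not_0_INR; lia).
  apply (is_RInt_Rext (fun t => ((x - t) ^ S j * t ^ i - INR (S j) / INR (S i) * ((x - t) ^ j * t ^ S i))
    - (- (INR (S j) / INR (S i))) * ((x - t) ^ j * t ^ S i))); [intros; ring|].
  replace (INR (fact i) * INR (fact (S j)) / INR (fact (S (i + S j))) * x ^ S (i + S j))
    with (/ INR (S i) * ((x - x) ^ S j * x ^ S i) - / INR (S i) * ((x - 0) ^ S j * 0 ^ S i)
      - (- (INR (S j) / INR (S i))) *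
        (INR (fact (S i)) * INR (fact j) / INR (fact (S (S i + j))) * x ^ S (S i + j))).
  2: { replace (S i + j)%nat with (i + S j)%nat by lia.
       rewrite Rminus_diag, !(pow_i (S _)) by lia.
       rewrite (fact_simpl j), (fact_simpl i), !mult_INR; field; repeat split; apply INR_fact_neq_0 || apply Hi. }
  apply is_RInt_Rminus; [|apply is_RInt_Rmult, IH].
  apply (is_RInt_derive_everywhere (fun t => / INR (S i) * ((x - t) ^ S j * t ^ S i)));
    intros t; auto_derive; trivial.
  change (match i with 0%nat => 1 | S _ => INR i + 1 end) with (INR (S i)).
  change (match j with 0%nat => 1 | S _ => INR j + 1 end) with (INR (S j)).
  change (x + - t) with (x - t); rewrite <- !tech_pow_Rmult; field; easy.
Qed.

Definition cos_term (y : R) (k : nat) : R := (-1) ^ k * y ^ (2 * k) / INR (fact (2 * k)).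

Lemma cos_term_S y k :
  (2 * INR k + 2) * (2 * INR k + 1) * cos_term y (S k) = - (y ^ 2 * cos_term y k).
Proof.
unfold cos_term; replace (2 * S k)%nat with (S (S (2 * k))) by lia.
rewrite !fact_simpl, !mult_INR, !S_INR, mult_INR; simpl (INR 2).
rewrite <- !tech_pow_Rmult; pose proof (pos_INR k).
field; repeat split; try apply INR_fact_neq_0; lra.
Qed.

(** Taylor's formula for [cos (n * x)] with integral remainder after degree [2 * j]. Each induction
    step amounts to two integrations by parts. *)
Lemma sine_power_integral n x j : n <> 0 ->
  is_RInt (fun t => (x - t) ^ (2 * j) * sin (n * t)) 0 x
    ((-1) ^ S j * INR (fact (2 * j)) / n ^ S (2 * j) * (cos (n * x) - sum_n (cos_term (n * x)) j)).
Proof.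
intros Hn; induction j as [|j IH].
- rewrite sum_O; unfold cos_term.
  replace ((-1) ^ 1 * INR (fact (2 * 0)) / n ^ S (2 * 0) *
     (cos (n * x) - (-1) ^ 0 * (n * x) ^ (2 * 0) / INR (fact (2 * 0))))
    with (- / n * cos (n * x) - - / n * cos (n * 0))
    by (rewrite Rmult_0_r, cos_0; simpl; field; easy).
  apply (is_RInt_derive_everywhere (fun t => - / n * cos (n * t))); intros t; auto_derive; trivial.
  simpl; field; easy.
- set (F := INR (fact (2 * j))) in *.
  set (b := (2 * INR j + 2) * (2 * INR j + 1)).
  apply (is_RInt_Rext (fun t => ((x - t) ^ (2 * S j) * sin (n * t) + b / n ^ 2 * ((x - t) ^ (2 * j) * sin (n * t)))
    - b / n ^ 2 * ((x - t) ^ (2 * j) * sin (n * t)))); [intros; ring|].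
  evar_last.
  + apply is_RInt_Rminus; [|apply is_RInt_Rmult, IH].
    apply (is_RInt_derive_everywhere
      (fun t => - / n * ((x - t) ^ S (S (2 * j)) * cos (n * t))
                - (2 * INR j + 2) / n ^ 2 * ((x - t) ^ S (2 * j) * sin (n * t))));
      intros t; auto_derive; trivial.
    change (j + (j + 0))%nat with (2 * j)%nat.
    change (match (2 * j)%nat with 0%nat => 1 | S _ => INR (2 * j) + 1 end)
      with (INR (S (2 * j))).
    rewrite !S_INR, mult_INR; simpl (INR 2).
    replace (2 * S j)%nat with (S (S (2 * j))) by lia.
    change (x + - t) with (x - t); rewrite <- !tech_pow_Rmult; unfold b; field; easy.
  + cbv beta; rewrite Rminus_diag, Rminus_0_r, Rmult_0_r, cos_0, sin_0, !(pow_i (S _)) by lia.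
    rewrite sum_n_RS.
    replace (2 * S j)%nat with (S (S (2 * j))) by lia.
    rewrite !fact_simpl, !mult_INR, !S_INR, mult_INR; simpl (INR 2).
    unfold cos_term at 3. replace (2 * S j)%nat with (S (S (2 * j))) by lia.
    rewrite !fact_simpl, !mult_INR, !S_INR, mult_INR; simpl (INR 2).
    rewrite !Rpow_mult_distr, <- !tech_pow_Rmult.
    fold F; unfold b.
    assert (Hm : (-1) ^ j * (-1) ^ j = 1) by (rewrite <- Rpow_mult_distr; replace (-1 * -1) with 1 by ring; apply pow1).
    assert (HF : F <> 0) by apply INR_fact_neq_0.
    pose proof (pos_INR j).
    set (e := (-1) ^ j) in *.
    apply Rminus_diag_uniq.
    (* The signs of the prefactor and of the new Taylor term multiply to [e * e], replaced by [1]
       separately. *)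
    transitivity (x ^ (2 * j) * x * x / n * (1 - e * e)); [|rewrite Hm; ring].
    field; repeat split; try apply pow_nonzero; trivial; lra.
Qed.

(** By [cos_term_S], multiplication by [y ^ 2] shifts the index by one and contributes
    [- 2 k (2 k - 1)] to the coefficient at [k]. *)
Lemma cos_term_sum y c m :
  y ^ 2 * sum_n (cos_term y) m + c * sum_n (cos_term y) (S m)
  = sum_n (fun k => (c - 2 * INR k * (2 * INR k - 1)) * cos_term y k) (S m).
Proof.
induction m as [|m IH].
- rewrite !sum_n_RS, !sum_O; pose proof (cos_term_S y 0); simpl INR in *; lra.
- rewrite (sum_n_RS (cos_term y) (S m)), (sum_n_RS _ (S m)), <- IH.
  rewrite (sum_n_RS (cos_term y) m); pose proof (cos_term_S y (S m)).
  rewrite (S_INR (S m)) in *; lra.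
Qed.

(** Since [t * (2 * x - t) = x ^ 2 - (x - t) ^ 2], two cases of [sine_power_integral] are
    subtracted. With [r = m + 1], the Taylor sums merge through [2 r (2 r - 1) - 2 k (2 k - 1) = 2
    (r - k) (2 r + 2 k - 1)], which vanishes at [k = r]. *)
Lemma weighted_sine_integral n x m : n <> 0 ->
  RInt (fun t => t * ((2 * x - t) * (x - t) ^ (2 * m)) * sin (n * t)) 0 x
  = (-1) ^ S m * INR (fact (2 * m)) *
    (x ^ 2 * (cos (n * x) * / n ^ S (2 * m))
     + (2 * INR m + 2) * (2 * INR m + 1) * (cos (n * x) * / n ^ S (S (S (2 * m))))
     - / n ^ S (S (S (2 * m)))
       * sum_n (fun k => 2 * (INR (S m) - INR k) * (2 * INR (S m) + 2 * INR k - 1) * cos_term (n * x) k) m).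
Proof.
intros Hn; apply (is_RInt_unique (V := R_CompleteNormedModule)).
apply (is_RInt_Rext (fun t => x ^ 2 * ((x - t) ^ (2 * m) * sin (n * t)) - (x - t) ^ (2 * S m) * sin (n * t))).
{ intros t; replace (2 * S m)%nat with (S (S (2 * m))) by lia; rewrite <- !tech_pow_Rmult; ring. }
evar_last; [apply is_RInt_Rminus; [apply is_RInt_Rmult|]; now apply sine_power_integral|].
assert (H : (n * x) ^ 2 * sum_n (cos_term (n * x)) m
    + (2 * INR m + 2) * (2 * INR m + 1) * sum_n (cos_term (n * x)) (S m)
  = sum_n (fun k => 2 * (INR (S m) - INR k) * (2 * INR (S m) + 2 * INR k - 1) * cos_term (n * x) k) m).
{ rewrite cos_term_sum, sum_n_RS.
  rewrite (sum_n_Rext _ (fun k => 2 * (INR (S m) - INR k) * (2 * INR (S m) + 2 * INR k - 1) * cos_term (n * x) k)).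
  - rewrite S_INR; ring.
  - intros k _; rewrite S_INR; ring. }
rewrite <- H; replace (2 * S m)%nat with (S (S (2 * m))) by lia.
rewrite !fact_simpl, !mult_INR, !S_INR, mult_INR; simpl (INR 2); rewrite <- !tech_pow_Rmult.
field; repeat split; try apply pow_nonzero; exact Hn.
Qed.

(** * Series twisted by [cos (n PI / 3)] *)

Definition multiple_ind (d n : nat) : R := if Nat.eqb (n mod d) 0 then 1 else 0.

(** Indexing by [n] itself suits divisibility; the added term at [n = 0] is [/ 0], which is [0] by
    convention. *)
Lemma is_series_zeta_nat s : (2 <= s)%nat -> is_series (fun n => / INR n ^ s) (zeta_nat s).
Proof.
intros Hs; apply (is_series_decr_1 (V := R_NormedModule)).
replace (plus _ _) with (zeta_nat s).
- now apply Series_correct, ex_series_inv_pow.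
- unfold plus, opp; simpl; rewrite pow_i, Rinv_0 by lia; ring.
Qed.

(** Comparison gives convergence; the sum is then computed along the partial sums up to [d * N]. *)
Lemma is_series_multiples d s : (1 <= d)%nat -> (2 <= s)%nat ->
  is_series (fun n => multiple_ind d n * / INR n ^ s) (/ INR d ^ s * zeta_nat s).
Proof.
intros Hd Hs; set (a := fun n => multiple_ind d n * / INR n ^ s).
assert (Hz := is_series_zeta_nat s Hs).
assert (Hmod : forall N k, (k < d)%nat -> ((d * N + k) mod d = k)%nat).
{ intros N k Hk; rewrite Nat.add_comm, Nat.mul_comm, Nat.Div0.mod_add; now apply Nat.mod_small. }
(* Nothing is added between two multiples of [d], so partial sums are constant on each block. *)
assert (Hblock : forall N k, (k < d)%nat -> sum_n a (d * N + k) = sum_n (fun j => a (d * j)%nat) N).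
{ assert (Hin : forall N, sum_n a (d * N) = sum_n (fun j => a (d * j)%nat) N ->
    forall k, (k < d)%nat -> sum_n a (d * N + k) = sum_n (fun j => a (d * j)%nat) N).
  { intros N HN k; induction k as [|k IH]; intros Hk; [now rewrite Nat.add_0_r|].
    rewrite Nat.add_succ_r, sum_n_RS, IH by lia.
    unfold a at 2; unfold multiple_ind; rewrite <- Nat.add_succ_r, Hmod by easy; simpl; ring. }
  intros N; induction N as [|N IH]; apply Hin.
  - now rewrite Nat.mul_0_r, !sum_O, Nat.mul_0_r.
  - assert (E : (d * S N = S (d * N + (d - 1)))%nat) by lia.
    rewrite (sum_n_RS _ N), <- (IH (d - 1)%nat), E, sum_n_RS by lia; reflexivity. }
assert (Ha : ex_series a).
{ apply (ex_series_le (V := R_CompleteNormedModule) _ (fun n => / INR n ^ s)); [|eexists; exact Hz].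
  intros n; change norm with Rabs; unfold a, multiple_ind.
  assert (0 <= / INR n ^ s).
  { destruct n as [|n]; [simpl INR; rewrite pow_i, Rinv_0 by lia; lra|].
    apply Rlt_le, Rinv_0_lt_compat, pow_lt, lt_0_INR; lia. }
  destruct (Nat.eqb _ _); rewrite Rabs_pos_eq; lra. }
destruct Ha as [l Hl].
assert (H1 : is_lim_seq (fun N => sum_n a (d * N)) l).
{ apply (is_lim_seq_subseq (sum_n a) l (fun N => d * N)%nat); [|exact Hl].
  apply eventually_subseq; intros; nia. }
assert (H2 : is_lim_seq (fun N => sum_n a (d * N)) (/ INR d ^ s * zeta_nat s)).
{ apply (is_lim_seq_ext (sum_n (fun n => / INR d ^ s * / INR n ^ s))).
  - intros N; rewrite <- (Nat.add_0_r (d * N)), Hblock by lia.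
    apply sum_n_Rext; intros j _; unfold a, multiple_ind.
    rewrite <- (Nat.add_0_r (d * j)) at 1; rewrite Hmod by lia; simpl Nat.eqb; cbv iota.
    rewrite mult_INR, Rpow_mult_distr, Rinv_mult; ring.
  - exact (is_series_Rmult (/ INR d ^ s) _ _ Hz). }
replace (/ INR d ^ s * zeta_nat s) with l; [exact Hl|].
apply is_lim_seq_unique in H1; apply is_lim_seq_unique in H2; rewrite H1 in H2; congruence.
Qed.

(** Both sides have period [6], so six values decide. *)
Lemma cos_INR_PI3 n :
  cos (INR n * (PI / 3))
  = / 2 * (1 - 2 * multiple_ind 2 n - 3 * multiple_ind 3 n + 6 * multiple_ind 6 n).
Proof.
assert (H3 : forall u, cos (u + 3 * (PI / 3)) = - cos u).
{ intros u; rewrite <- neg_cos; f_equal; field. }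
assert (Hp : forall d k m, multiple_ind d (m + k * d) = multiple_ind d m).
{ intros d k m; unfold multiple_ind; now rewrite Nat.Div0.mod_add. }
assert (H6 : forall m, cos (INR (m + 6) * (PI / 3)) = cos (INR m * (PI / 3))).
{ intros m; rewrite plus_INR; simpl (INR 6).
  replace ((INR m + (1 + 1 + 1 + 1 + 1 + 1)) * (PI / 3))
    with (INR m * (PI / 3) + 3 * (PI / 3) + 3 * (PI / 3)) by ring.
  rewrite !H3; ring. }
assert (Hc2 : cos (2 * (PI / 3)) = - / 2) by (rewrite cos_2a_cos, cos_PI3; field).
induction n as [n IH] using (well_founded_induction Wf_nat.lt_wf).
destruct (Compare_dec.le_lt_dec 6 n) as [Hn|Hn].
- replace n with (n - 6 + 6)%nat by lia; rewrite H6, IH by lia.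
  rewrite (Hp 6%nat 1%nat), (Hp 2%nat 3%nat), (Hp 3%nat 2%nat); reflexivity.
- do 6 try destruct n as [|n]; try lia; unfold multiple_ind; simpl.
  + rewrite Rmult_0_l, cos_0; field.
  + rewrite Rmult_1_l, cos_PI3; field.
  + replace (1 + 1) with 2 by ring; rewrite Hc2; field.
  + replace ((1 + 1 + 1) * (PI / 3)) with (0 + 3 * (PI / 3)) by ring; rewrite H3, cos_0; field.
  + replace ((1 + 1 + 1 + 1) * (PI / 3)) with (PI / 3 + 3 * (PI / 3)) by ring; rewrite H3, cos_PI3; field.
  + replace ((1 + 1 + 1 + 1 + 1) * (PI / 3)) with (2 * (PI / 3) + 3 * (PI / 3)) by ring; rewrite H3, Hc2; field.
Qed.

Lemma is_series_cos_PI3 s : (2 <= s)%nat ->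
  is_series (fun n => cos (INR (S n) * (PI / 3)) * / INR (S n) ^ s)
    (/ 2 * (1 - 2 / 2 ^ s - 3 / 3 ^ s + 6 / 6 ^ s) * zeta_nat s).
Proof.
intros Hs.
apply (is_series_incr_1 (V := R_NormedModule) (fun n => cos (INR n * (PI / 3)) * / INR n ^ s)).
replace (plus _ _) with
  (/ 2 * (zeta_nat s - 2 * (/ INR 2 ^ s * zeta_nat s) - 3 * (/ INR 3 ^ s * zeta_nat s)
          - - 6 * (/ INR 6 ^ s * zeta_nat s))).
- apply (is_series_Rext (fun n => / 2 * (/ INR n ^ s - 2 * (multiple_ind 2 n * / INR n ^ s)
     - 3 * (multiple_ind 3 n * / INR n ^ s) - - 6 * (multiple_ind 6 n * / INR n ^ s)))).
  + intros n; rewrite cos_INR_PI3; ring.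
  + assert (Hm : forall d, (1 <= d)%nat -> forall c,
      is_series (fun n => c * (multiple_ind d n * / INR n ^ s)) (c * (/ INR d ^ s * zeta_nat s)))
      by (intros d Hd c; now apply is_series_Rmult, is_series_multiples).
    apply is_series_Rmult, is_series_Rminus; [apply is_series_Rminus; [apply is_series_Rminus|]|].
    * now apply is_series_zeta_nat.
    * apply Hm; lia.
    * apply Hm; lia.
    * apply Hm; lia.
- unfold plus; simpl (AbelianMonoid.plus _ _); change (INR 0) with 0; rewrite (pow_i s), Rinv_0 by lia.
  replace (INR 2) with 2 by (simpl; ring); replace (INR 3) with 3 by (simpl; ring);
    replace (INR 6) with 6 by (simpl; ring).
  field; repeat split; apply pow_nonzero; lra.
Qed.

Lemma Series_sum_n_le (a : nat -> nat -> R) M : (forall m, (m <= M)%nat -> ex_series (a m)) ->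
  is_series (fun n => sum_n (fun m => a m n) M) (sum_n (fun m => Series (a m)) M).
Proof.
induction M as [|M IH]; intros Ha.
- rewrite sum_O; apply (is_series_Rext (a 0%nat)); [intros n; now rewrite sum_O|].
  now apply Series_correct, Ha.
- rewrite sum_n_RS; apply (is_series_Rext (fun n => sum_n (fun m => a m n) M + a (S M) n));
    [intros n; now rewrite sum_n_RS|].
  apply is_series_Rplus; [apply IH; auto|now apply Series_correct, Ha].
Qed.

(** At [x = PI / 3] and [r = m + 1], this is [-2] times the coefficient of zeta(2r + 1 - 2k) in the
    finite sum of the theorem for [k >= 1]; index [0] contributes to zeta(2r + 1) itself. *)
Definition taylor_coef (x : R) (m k : nat) : R :=
  2 * (INR (S m) - INR k) * (2 * INR (S m) + 2 * INR k - 1) / INR (fact (2 * k))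
  * ((-1) ^ k * x ^ (2 * k)).

(** The even power in [cos_term] lowers the exponent to [2 * m + 3 - 2 * k], at least [3] for
    [k <= m], so each series converges. *)
Lemma is_series_taylor x m :
  is_series (fun n => / INR (S n) ^ S (S (S (2 * m))) *
     sum_n (fun k => 2 * (INR (S m) - INR k) * (2 * INR (S m) + 2 * INR k - 1)
                     * cos_term (INR (S n) * x) k) m)
    (sum_n (fun k => taylor_coef x m k * zeta_nat (2 * m + 3 - 2 * k)) m).
Proof.
assert (Hk : forall k, (k <= m)%nat ->
  is_series (fun n => taylor_coef x m k * / INR (S n) ^ (2 * m + 3 - 2 * k))
    (taylor_coef x m k * zeta_nat (2 * m + 3 - 2 * k))).
{ intros k Hk; apply is_series_Rmult, Series_correct, ex_series_inv_pow; lia. }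
apply (is_series_Rext (fun n => sum_n (fun k => taylor_coef x m k * / INR (S n) ^ (2 * m + 3 - 2 * k)) m)).
- intros n; rewrite <- sum_n_Rmult; apply sum_n_Rext; intros k Hkm.
  assert (Hn : INR (S n) <> 0) by (apply not_0_INR; lia).
  replace (S (S (S (2 * m))))%nat with (2 * m + 3 - 2 * k + 2 * k)%nat by lia.
  unfold taylor_coef, cos_term; rewrite pow_add, Rpow_mult_distr.
  field; repeat split; try apply pow_nonzero; trivial; apply INR_fact_neq_0.
- rewrite (sum_n_Rext _ (fun k => Series (fun n => taylor_coef x m k * / INR (S n) ^ (2 * m + 3 - 2 * k)))).
  + apply Series_sum_n_le; intros k Hkm; eexists; now apply Hk.
  + intros k Hkm; symmetry; now apply is_series_unique, Hk.
Qed.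

(** Half the product of 1 - 2^(1-s) and 1 - 3^(1-s), expanded. *)
Definition cos_PI3_factor (s : nat) : R := / 2 * (1 - 2 / 2 ^ s - 3 / 3 ^ s + 6 / 6 ^ s).

Lemma is_series_weighted_sine m : (1 <= m)%nat ->
  is_series (fun n => RInt (fun t => t * ((2 * (PI / 3) - t) * (PI / 3 - t) ^ (2 * m))
                                     * sin (INR (S n) * t)) 0 (PI / 3))
    ((-1) ^ S m * INR (fact (2 * m)) *
     ((PI / 3) ^ 2 * (cos_PI3_factor (2 * m + 1) * zeta_nat (2 * m + 1))
      + (2 * INR m + 2) * (2 * INR m + 1) * (cos_PI3_factor (2 * m + 3) * zeta_nat (2 * m + 3))
      - sum_n (fun k => taylor_coef (PI / 3) m k * zeta_nat (2 * m + 3 - 2 * k)) m)).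
Proof.
intros Hm.
eapply is_series_Rext; [intros n; symmetry; apply weighted_sine_integral, not_0_INR; lia|].
cbv beta; apply is_series_Rmult, is_series_Rminus; [apply is_series_Rplus|apply is_series_taylor].
- apply is_series_Rmult; replace (S (2 * m)) with (2 * m + 1)%nat by lia.
  (* Here [1 <= m] keeps the exponent [2 * m + 1] away from the harmonic series. *)
  apply is_series_cos_PI3; lia.
- apply is_series_Rmult; replace (S (S (S (2 * m)))) with (2 * m + 3)%nat by lia.
  apply is_series_cos_PI3; lia.
Qed.

(** * Beta integrals and the series in the even zeta values *)

Definition tail_coef (m k : nat) : R :=
  INR (fact (2 * k)) * (4 * INR (S m) + 2 * INR k - 1) / INR (fact (2 * S m + 2 * k)) / 6 ^ (2 * k).

(** Splitting [2 * x - t] as [x + (x - t)] gives two beta integrals. *)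
Lemma weighted_power_integral x m i :
  RInt (fun t => (2 * x - t) * (x - t) ^ (2 * m) * t ^ i) 0 x
  = INR (fact (2 * m)) * INR (fact i) * (4 * INR m + INR i + 3) / INR (fact (2 * S m + i))
    * x ^ (2 * S m + i).
Proof.
apply (is_RInt_unique (V := R_CompleteNormedModule)).
apply (is_RInt_Rext (fun t => x * ((x - t) ^ (2 * m) * t ^ i) + (x - t) ^ S (2 * m) * t ^ i)).
{ intros t; rewrite <- tech_pow_Rmult; ring. }
evar_last; [apply is_RInt_Rplus; [apply is_RInt_Rmult|]; apply beta_integral|].
replace (i + S (2 * m))%nat with (S (i + 2 * m)) by lia.
replace (2 * S m + i)%nat with (S (S (i + 2 * m))) by lia.
rewrite (fact_simpl (2 * m)), (fact_simpl (S (i + 2 * m))), !mult_INR, !S_INR, plus_INR, mult_INR.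
rewrite <- !tech_pow_Rmult; simpl (INR 2).
pose proof (pos_INR i); pose proof (pos_INR m).
field; repeat split; try apply INR_fact_neq_0; lra.
Qed.

Lemma weighted_zeta_even_integral m M :
  RInt (fun t => (2 * (PI / 3) - t) * (PI / 3 - t) ^ (2 * m) * zeta_even_sum (t / (2 * PI)) M) 0 (PI / 3)
  = INR (fact (2 * m)) * (PI / 3) ^ (2 * S m) * sum_n (fun k => tail_coef m k * zeta_even k) M.
Proof.
pose proof PI_RGT_0 as Hpi.
set (q := fun t => (2 * (PI / 3) - t) * (PI / 3 - t) ^ (2 * m)).
assert (Hd : forall k t, ex_derive (fun t => zeta_even k / (2 * PI) ^ (2 * k) * (q t * t ^ (2 * k))) t)
  by (intros k t; unfold q; now auto_derive).
rewrite (RInt_ext _ (fun t => sum_n (fun k => zeta_even k / (2 * PI) ^ (2 * k) * (q t * t ^ (2 * k))) M)).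
- rewrite (is_RInt_unique (V := R_CompleteNormedModule) _ _ _ _ (is_RInt_sum_n _ 0 (PI / 3) M Hd)).
  rewrite <- sum_n_Rmult; apply sum_n_Rext; intros k _.
  rewrite (RInt_scal (V := R_CompleteNormedModule)).
  2: { apply ex_RInt_derivable; intros t; unfold q; now auto_derive. }
  unfold q; rewrite weighted_power_integral.
  match goal with |- scal ?u ?v = _ => change (scal u v) with (u * v) end.
  unfold tail_coef; rewrite (pow_add (PI / 3)).
  (* The ratio of [PI / 3] to [2 * PI] is the source of [6 ^ (2 * k)] in [tail_coef]. *)
  replace ((PI / 3) ^ (2 * k)) with ((2 * PI) ^ (2 * k) / 6 ^ (2 * k))
    by (unfold Rdiv; rewrite <- pow_inv, <- Rpow_mult_distr; f_equal; field).
  rewrite (mult_INR 2 k), (S_INR m); simpl (INR 2).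
  field; repeat split; try apply pow_nonzero; try apply INR_fact_neq_0; lra.
- intros t _; unfold zeta_even_sum; fold (q t).
  rewrite <- sum_n_Rmult; apply sum_n_Rext; intros k _.
  unfold Rdiv; rewrite Rpow_mult_distr, pow_inv; ring.
Qed.

(** The two evaluations meet: [series_sine_integrals] equates the summed sine integrals with the
    limit of the truncated beta integrals, and the common [(2 m)!] cancels. *)
Lemma is_series_tail m : (1 <= m)%nat -> exists T : R,
  is_series (fun k => tail_coef m k * zeta_even k) T /\
  -2 * (PI / 3) ^ (2 * S m) * T = (-1) ^ S m *
   ((PI / 3) ^ 2 * (cos_PI3_factor (2 * m + 1) * zeta_nat (2 * m + 1))
      + (2 * INR m + 2) * (2 * INR m + 1) * (cos_PI3_factor (2 * m + 3) * zeta_nat (2 * m + 3))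
      - sum_n (fun k => taylor_coef (PI / 3) m k * zeta_nat (2 * m + 3 - 2 * k)) m).
Proof.
intros Hm; pose proof PI_RGT_0 as Hpi.
pose proof (is_series_weighted_sine m Hm) as HL.
set (R0 := _ - _) in *.
set (x := PI / 3) in *; set (F := INR (fact (2 * m))) in *.
assert (Hx : 0 < x) by (unfold x; lra).
assert (HF : F <> 0) by apply INR_fact_neq_0.
assert (Hxr : x ^ (2 * S m) <> 0) by (apply pow_nonzero; lra).
(* The second conjunct solved for [T]; convergence to this value is what remains. *)
exists ((-1) ^ S m * R0 / (-2 * x ^ (2 * S m))); split; [|field; easy].
(* The bound on the weight over [[0, x]] is taken factor by factor. *)
apply (series_sine_integrals _ _ (2 * x * x ^ (2 * m))) in HL.
- apply (is_lim_seq_scal_l _ (/ (-2 * F * x ^ (2 * S m)))) in HL.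
  simpl Rbar_mult in HL.
  apply (is_lim_seq_ext _ (sum_n (fun k => tail_coef m k * zeta_even k))) in HL.
  + replace (_ / _) with (/ (-2 * F * x ^ (2 * S m)) * ((-1) ^ S m * F * R0)) by (field; easy).
    exact HL.
  + intros M; unfold x; rewrite weighted_zeta_even_integral; fold x F; field; easy.
- unfold x in *; lra.
- apply C2_mult; [|apply C2_pow]; [apply (C2_ext (fun t => -1 * t + 2 * x))|apply (C2_ext (fun t => -1 * t + x))];
    try apply C2_affine; intros; ring.
- intros t Ht; rewrite Rabs_mult, !Rabs_pos_eq; try apply pow_le; try lra.
  apply Rmult_le_compat; try apply pow_le; try lra; apply pow_incr; lra.
Qed.

(** * Passage to the complex zeta function and final algebra *)

Lemma sum_n_first (a : nat -> R) n : sum_n a (S n) = a 0%nat + sum_n (fun k => a (S k)) n.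
Proof.
induction n as [|n IH]; [now rewrite sum_n_RS, !sum_O|].
rewrite sum_n_RS, IH, sum_n_RS; apply Rplus_assoc.
Qed.

Lemma zeta_INR s : (2 <= s)%nat -> zeta (RtoC (INR s)) = RtoC (zeta_nat s).
Proof.
intros Hs; rewrite zeta_real_gt1 by (apply (lt_INR 1); lia).
f_equal; apply Series_ext; intros n.
rewrite Rpower_Ropp, Rpower_pow; [easy|apply lt_0_INR; lia].
Qed.

Lemma zeta_even_eq k : zeta (RtoC (2 * INR k)) = RtoC (zeta_even k).
Proof.
destruct k as [|k]; [simpl INR; rewrite Rmult_0_r; exact zeta_0|].
change (zeta_even (S k)) with (zeta_nat (2 * S k)).
rewrite <- zeta_INR, mult_INR by lia; reflexivity.
Qed.

Lemma is_series_RtoC (a : nat -> R) (l : R) :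
  is_series a l -> is_series (fun k => RtoC (a k)) (RtoC l).
Proof.
intros H; apply (filterlim_ext (fun n => RtoC (sum_n a n))).
- intros n; symmetry; apply sum_n_RtoC.
- apply (filterlim_comp _ _ _ (sum_n a) RtoC _ (locally l)); [exact H|].
  intros P [eps HP]; exists eps; intros y Hy; apply HP; split; [exact Hy|apply ball_center].
Qed.

Theorem theorem4p6 (r : nat) (hr : (2 <= r)%nat) :
  let D : R := INR r * (2 * INR r - 1)
               * (3 ^ (2 * r) * (2 ^ (2 * r) + 1) + 2 ^ (2 * r) - 1) in
  exists T : C,
    is_series
      (fun k : nat =>
         Cmult (RtoC (INR (fact (2 * k)) * (4 * INR r + 2 * INR k - 1)
                      / INR (fact (2 * r + 2 * k)) / 6 ^ (2 * k)))
               (zeta (RtoC (2 * INR k)))) T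
    /\
    zeta (RtoC (2 * INR r + 1)) =
    Cplus
      (Cmult (RtoC (2 * PI ^ 2
                    * (6 ^ (2 * r - 2) - 3 ^ (2 * r - 2) - 2 ^ (2 * r - 2) + 1)
                    / D))
             (zeta (RtoC (2 * INR r - 1))))
      (Cmult (RtoC (2 * 6 ^ (2 * r) / D))
         (Cplus
            (sum_n_m
               (fun k : nat =>
                  Cmult (RtoC ((-1) ^ (k - 1)
                               * ((INR r - INR k) * (2 * INR r + 2 * INR k - 1)
                                  / INR (fact (2 * k)))
                               * (PI / 3) ^ (2 * k)))
                        (zeta (RtoC (2 * INR r + 1 - 2 * INR k))))
               1 (r - 1))
            (Cmult (RtoC ((-1) ^ r * (PI / 3) ^ (2 * r))) T))).
Proof.
(* From here [m = r - 1], at least [1]. *)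
destruct r as [|[|p]]; [lia|lia|]; clear hr; set (m := S p); intros D.
destruct (is_series_tail m ltac:(lia)) as (T & HT & Heq).
exists (RtoC T); split.
{ apply is_series_RtoC in HT; revert HT; apply is_series_ext; intros k.
  now rewrite zeta_even_eq, <- RtoC_mult. }
replace (S m - 1)%nat with (S p) by lia.
rewrite <- sum_n_m_S.
change (sum_n_m ?f 0 p) with (sum_n f p).
rewrite (sum_n_ext_loc _ (fun k => RtoC (- / 2 * (taylor_coef (PI / 3) m (S k) * zeta_nat (2 * m + 3 - 2 * S k))))).
2: { intros k Hk.
     replace (2 * INR (S m) + 1 - 2 * INR (S k)) with (INR (2 * m + 3 - 2 * S k))
       by (rewrite minus_INR, plus_INR, !mult_INR, !S_INR by lia; simpl; ring).
     rewrite zeta_INR, <- RtoC_mult by lia; f_equal.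
     unfold taylor_coef; replace (S k - 1)%nat with k by lia.
     rewrite <- (tech_pow_Rmult (-1)); field; apply INR_fact_neq_0. }
rewrite sum_n_RtoC, sum_n_Rmult.
replace (2 * INR (S m) + 1) with (INR (2 * m + 3))
  by (rewrite plus_INR, mult_INR, (S_INR m); simpl; ring).
replace (2 * INR (S m) - 1) with (INR (2 * m + 1))
  by (rewrite plus_INR, mult_INR, (S_INR m); simpl; ring).
rewrite !zeta_INR by lia.
rewrite <- !RtoC_mult, <- !RtoC_plus, <- RtoC_mult, <- RtoC_plus; f_equal.
set (S1 := sum_n _ p); set (Z1 := zeta_nat (2 * m + 1)) in *; set (Z3 := zeta_nat (2 * m + 3)) in *.
(* Index [0] of the Taylor sum is a second occurrence of zeta(2r + 1), split off from the finite sum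
   of the theorem. *)
assert (HS : sum_n (fun k => taylor_coef (PI / 3) m k * zeta_nat (2 * m + 3 - 2 * k)) m
             = 2 * (INR m + 1) * (2 * INR m + 1) * Z3 + S1).
{ etransitivity; [exact (sum_n_first _ p)|]; fold S1; f_equal.
  unfold taylor_coef; rewrite Nat.mul_0_r, Nat.sub_0_r, (S_INR m); fold Z3; simpl; field. }
rewrite HS in Heq; clearbody S1; clear HS HT.
assert (He : (-1) ^ S m * (-1) ^ S m = 1)
  by (rewrite <- Rpow_mult_distr; replace (-1 * -1) with 1 by ring; apply pow1).
rewrite (Rmult_assoc _ _ T).
replace ((PI / 3) ^ (2 * S m) * T) with (- / 2 * (-2 * (PI / 3) ^ (2 * S m) * T)) by field.
rewrite Heq.
(* The sign [(-1) ^ r] of the theorem meets the one in [Heq], and the two cancel. *)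
match goal with |- context [(-1) ^ S m * (- / 2 * ((-1) ^ S m * ?e))] =>
  replace ((-1) ^ S m * (- / 2 * ((-1) ^ S m * e))) with (- / 2 * e)
    by (rewrite <- (Rmult_1_l (- / 2 * e)), <- He; ring) end.
(* Collecting zeta(2r + 1) leaves the coefficient [2 r (2 r - 1) (1 - cos_PI3_factor (2 r + 1))],
   and [D] is [6 ^ (2 r)] times it. *)
unfold D, cos_PI3_factor; rewrite (S_INR m).
replace (2 * S m - 2)%nat with (2 * m)%nat by lia.
replace (2 * S m)%nat with (S (S (2 * m))) by lia.
replace (2 * m + 1)%nat with (S (2 * m)) by lia.
replace (2 * m + 3)%nat with (S (S (S (2 * m)))) by lia.
replace 6 with (2 * 3) by ring; rewrite !Rpow_mult_distr, <- !tech_pow_Rmult.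
(* Once all powers are expressed by [E2] and [E3], a rational identity remains; these bounds keep
   its denominators nonzero. *)
assert (H2 : 1 <= 2 ^ (2 * m)) by (apply pow_R1_Rle; lra).
assert (H3 : 1 <= 3 ^ (2 * m)) by (apply pow_R1_Rle; lra).
pose proof (pos_INR m) as Hm.
set (E2 := 2 ^ (2 * m)) in *; set (E3 := 3 ^ (2 * m)) in *; clearbody E2 E3.
field; repeat split; nra.
Qed.
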